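(* Let $m,n\ge 2$. Every 2D word of size $(m,n)$ (over any finite alphabet) has at most $a$ distinct non-empty HV-palindromic factors, where $$a=\frac{m}{2}\Big(\big(\tfrac{m}{2}+1\big)n-m+2\Big)\ \text{ if } m \text{ is even},\qquad a=(n-2)\Big(\frac{m+1}{2}\Big)^2+2m\ \text{ if } m \text{ is odd}.$$
   Context: A 2D word of size $(m,n)$ over a finite alphabet $\Sigma$ is an $m\times n$ array $w=[w_{i,j}]$ with entries in $\Sigma$; its rows and columns are 1D words. A factor of $w$ is a sub-array $[w_{i,j}]_{a\le i\le b,\,c\le j\le d}$ of consecutive rows and columns; factors are counted as distinct arrays, independently of their positions. A 1D word is a palindrome if it equals its reversal, and a 2D word is an HV-palindrome if each of its rows and each of its columns is a 1D palindrome. *)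

(* Defs.v *)
From mathcomp Require Import all_boot all_order all_algebra.

Set Implicit Arguments.
Unset Strict Implicit.
Unset Printing Implicit Defensive.

Section Words2D.

Variable T : finType.

Definition palindrome (s : seq T) : bool := s == rev s.

Definition row_word p q (u : 'M[T]_(p, q)) (i : 'I_p) : seq T :=
  [seq u i j | j : 'I_q].

Definition col_word p q (u : 'M[T]_(p, q)) (j : 'I_q) : seq T :=
  [seq u i j | i : 'I_p].

Definition HV_palindrome p q (u : 'M[T]_(p, q)) : bool :=
  [forall i, palindrome (row_word u i)] &&
  [forall j, palindrome (col_word u j)].

(* The p x q array u occurs in w with upper left corner at (a, c).  The
   entries of w are named by k and l to avoid building the ordinals of
   values a + i and c + j. *)
Definition occurs_at m n p q (w : 'M[T]_(m, n)) (u : 'M[T]_(p, q))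
    (a c : nat) : bool :=
  [&& a + p <= m, c + q <= n &
    [forall i : 'I_p, forall j : 'I_q, forall k : 'I_m, forall l : 'I_n,
      (k == a + i :> nat) && (l == c + j :> nat) ==> (u i j == w k l)]].

Definition factor m n p q (w : 'M[T]_(m, n)) (u : 'M[T]_(p, q)) : bool :=
  [exists a : 'I_m.+1, exists c : 'I_n.+1, occurs_at w u a c].

(* Arrays of arbitrary size at most m x n, tagged with their size: a finite
   type in which every factor of a word of size (m, n) lives. *)
Definition small_word m n : finType :=
  {s : 'I_m.+1 * 'I_n.+1 & 'M[T]_(s.1, s.2)}.

Definition HV_palindromic_factors m n (w : 'M[T]_(m, n)) :
    {set small_word m n} :=
  [set u : small_word m n |
    [&& 0 < (tag u).1, 0 < (tag u).2,
        factor w (tagged u) & HV_palindrome (tagged u)]].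

End Words2D.

(* Main.v *)
(* Read a strip of p consecutive rows as a one-dimensional word over columns:
   its HV-palindromic factors are palindromes, and at each end column at most
   one of them is new in the strip.  An injection sends the palindromes that do
   not fit in the first two columns to pairs (end column >= 3, strip of odd
   height).

   - A palindrome of odd height goes to its first end in the topmost strip
     containing it.
   - If a palindrome of even height with a non-constant column is new at some
     end of its strip, then no palindrome is new at that end in the two strips
     obtained by dropping the first or the last row, so one of these is free.
   - If all columns are constant, dropping the first or the last row gives the
     same word v of odd height in two strips; only one of these is taken by v,
     so the other is free, unless v appears at the first two columns in both.

   The exception forces the palindrome to be a single column a^(2h).  If it
   occurs in a non-constant column of the array, that column has a
   non-palindromic window of length 2h+1, hence a free strip.  Otherwise
   a^(2h-1) occurs in both of the first two columns but never side by side.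
   Palindromes inside the first two columns are counted by those of each single
   column, a twin [y; y] taking the place of the second copy of y; the missing
   twin of a^(2h-1) leaves room for a^(2h).  The total is 2m + (n-2) times the
   number of intervals of odd length in m rows. *)
From Stdlib Require Import Classical.
Require Import Defs.
From mathcomp Require Import all_boot all_order all_algebra.
From mathcomp Require Import zify ring.

Set Implicit Arguments.
Unset Strict Implicit.

(** * Least witnesses and injective relations *)

Lemma ex_least (P : nat -> Prop) :
  (exists n, P n) -> exists n, P n /\ forall k, k < n -> ~ P k.
Proof.
case=> n; have [k] := ubnP n; elim: k n => // k IH n ltnk Pn.
have [[j [ltjn Pj]]|no] := classic (exists j, j < n /\ P j).
  by apply: IH Pj; apply: leq_trans ltjn _.
by exists n; split=> // j ltjn Pj; apply: no; exists j.
Qed.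

(** The injection is a relation because [charge] is propositional; each [y] found is removed from
    [t] before the next element is treated. *)
Lemma leq_size_rel (A B : eqType) (R : A -> B -> Prop) (s : seq A) (t : seq B) :
  uniq s -> (forall x, x \in s -> exists2 y, y \in t & R x y) ->
  (forall x x' y, R x y -> R x' y -> x = x') -> size s <= size t.
Proof.
move=> us st Rinj; elim: s t us st => //= x s IH t /andP[xs us] st.
have [|y yt Rxy] := st x; first by rewrite mem_head.
rewrite (perm_size (perm_to_rem yt)) /= ltnS; apply: IH => // x' x's.
have [|y' y't Rxy'] := st x'; first by rewrite in_cons x's orbT.
exists y' => //; move: y't; rewrite (perm_mem (perm_to_rem yt)) in_cons.
case/orP=> // /eqP eqy; rewrite eqy in Rxy'.
by rewrite -(Rinj _ _ _ Rxy' Rxy) x's in xs.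
Qed.

Definition pal (A : eqType) (s : seq A) : bool := s == rev s.

(** * Palindromic windows of a one-dimensional word *)

Section Window.

Variable A : eqType.
Implicit Types (f g : nat -> A) (u v : seq A).

Definition window f c q : seq A := [seq f j | j <- iota c q].

Lemma size_window f c q : size (window f c q) = q.
Proof. by rewrite size_map size_iota. Qed.

Lemma nth_window x f c q i : i < q -> nth x (window f c q) i = f (c + i).
Proof. by move=> ltiq; rewrite (nth_map 0) ?size_iota // nth_iota. Qed.

Lemma eq_windowP f g c d q :
  window f c q = window g d q <-> forall i, i < q -> f (c + i) = g (d + i).
Proof.
split=> [eqw i ltiq|eqw].
  by rewrite -(nth_window (f 0) _ _ ltiq) eqw nth_window.
apply: (@eq_from_nth _ (f 0)); rewrite !size_window // => i ltiq.
by rewrite !nth_window ?eqw.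
Qed.

Lemma window_nseqP f c q x :
  window f c q = nseq q x <-> forall i, i < q -> f (c + i) = x.
Proof.
have -> : nseq q x = window (fun=> x) c q.
  by apply: (@eq_from_nth _ x); rewrite ?size_nseq ?size_window // => i ltiq;
     rewrite nth_nseq ltiq nth_window.
exact: eq_windowP.
Qed.

Lemma pal_windowP f c q :
  pal (window f c q) <-> forall i, i < q -> f (c + i) = f (c + (q - i.+1)).
Proof.
split=> [/eqP eqw i ltiq|eqw].
  have ltrq : q - i.+1 < q by lia.
  rewrite -(nth_window (f 0) f c ltiq) eqw nth_rev size_window //.
  exact: nth_window.
apply/eqP/(@eq_from_nth _ (f 0)); rewrite ?size_rev // size_window => i ltiq.
have ltrq : q - i.+1 < q by lia.
rewrite nth_rev size_window //.
by rewrite (nth_window _ _ _ ltiq) (nth_window _ _ _ ltrq) eqw.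
Qed.

Lemma pal_suffix f c q d k :
  pal (window f c q) -> pal (window f d k) -> c <= d -> d + k = c + q ->
  window f c k = window f d k.
Proof.
move=> /pal_windowP pc /pal_windowP pd lecd e; apply/eq_windowP => i ltik.
rewrite pc ?(pd _ ltik); last by lia.
by congr f; lia.
Qed.

(** The reflections of the two windows compose to a shift by one place, so neighbouring letters
    agree. *)
Lemma pal_succ_const f s p :
  pal (window f s p) -> pal (window f s p.+1) ->
  window f s p.+1 = nseq p.+1 (f s).
Proof.
move=> /pal_windowP p0 /pal_windowP p1; apply/window_nseqP.
elim=> [_|i IH lti]; first by rewrite addn0.
rewrite (p1 _ lti) -(IH (ltnW lti)) (p0 _ lti); congr f; lia.
Qed.

Lemma window_nseqS f s k x : 0 < k ->
  window f s k = nseq k x -> window f s.+1 k = nseq k x ->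
  window f s k.+1 = nseq k.+1 x.
Proof.
move=> k0 /window_nseqP e0 /window_nseqP e1; apply/window_nseqP => -[|i] lti.
  exact: e0.
by rewrite addnS -addSn e1.
Qed.

Definition fresh f e u :=
  [/\ pal u, 0 < size u, exists2 c, c + size u = e & window f c (size u) = u
    & forall d, d + size u < e -> window f d (size u) <> u].

(* The shorter of two palindromes with the same end reappears, by reflection,
   as a prefix of the longer one. *)
Lemma fresh_inj f e u v : fresh f e u -> fresh f e v -> u = v.
Proof.
wlog le_vu : u v / size v <= size u.
  by move=> H fu fv; case/orP: (leq_total (size v) (size u)) => ?;
     [apply: H|apply/esym/H].
case=> pu u0 [c ce eu] _ [pv v0 [d de ev] nv].
have eqw : window f c (size v) = v.
  by rewrite -[RHS]ev; apply: (@pal_suffix _ _ (size u)); rewrite ?eu ?ev //; lia.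
have [lt|ge] := ltnP (c + size v) e; first by case: (nv _ lt).
have esz : size v = size u by lia.
by rewrite -eu -eqw esz.
Qed.

Lemma fresh_ex f c u : pal u -> 0 < size u -> window f c (size u) = u ->
  exists2 e, e <= c + size u & fresh f e u.
Proof.
move=> pu u0 eu.
have [|d [ed dmin]] := @ex_least (fun d => window f d (size u) = u).
  by exists c.
have le_dc : d <= c by rewrite leqNgt; apply/negP => /dmin; apply.
exists (d + size u); first by lia.
by split=> //; [exists d|move=> j lt; apply: dmin; lia].
Qed.

(* The window found is y x^k or x^k y with y <> x. *)
Lemma nonpal_window f m s k x : 2 <= k -> s + k <= m ->
  window f s k = nseq k x -> (exists2 i, i < m & f i <> x) ->
  exists z, [/\ z + k.+1 <= m, f z.+1 = x, ~ pal (window f z k.+1)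
    & ~ (z + k.+2 <= m /\ pal (window f z k.+2))].
Proof.
move=> k2 le_skm /window_nseqP es [i0 lt_i0m fi0].
have [[t [lt_tkm et ft]]|no] := classic (exists t,
    [/\ t + k < m, forall i, i < k -> f (t + i) = x & f (t + k) <> x]).
  have e0 := et 0 (ltnW k2); have e1 := et 1 k2.
  rewrite addn0 in e0; rewrite addn1 in e1.
  exists t; split=> //; first by lia.
    move=> /pal_windowP /(_ 0 isT); rewrite addn0 e0 subSS subn0 => e.
    by apply: ft.
  case=> _ /pal_windowP /(_ 1 isT); rewrite addn1 e1 !subSS subn0 => e.
  by apply: ft.
have tail i : s <= i -> i < m -> f i = x.
  elim/ltn_ind: i => i IH le_si lt_im; apply: NNPP => fi; apply: no.
  have le_ski : s + k <= i.
    rewrite leqNgt; apply/negP => lt; apply: fi.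
    by have := es (i - s); rewrite subnKC //; apply; lia.
  exists (i - k); split; first by lia.
    by move=> j ltjk; apply: IH; lia.
  by rewrite subnK //; lia.
(* Here [x] fills all places from [s] up to [m]; the least [d] makes [s - d.+1] the last place
   before [s] with another letter. *)
have [|d [[le_d fd] dmin]] := @ex_least (fun d => d < s /\ f (s - d.+1) <> x).
  have lt_i0s : i0 < s by rewrite ltnNge; apply/negP => /tail; auto.
  exists (s - i0.+1); split; first by lia.
  by have -> : s - (s - i0.+1).+1 = i0 by lia.
have tail' i : s - d.+1 < i -> i < m -> f i = x.
  move=> lt1 ltim; case: (leqP s i) => [/tail|lt_is]; first exact.
  apply: NNPP => fi; case: (@dmin (s - i.+1)); first by lia.
  split; first by lia.
  by have -> : s - (s - i.+1).+1 = i by lia.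
exists (s - d.+1); split; first by lia.
- by apply: tail'; lia.
- move=> /pal_windowP /(_ 0 isT); rewrite addn0 subSS subn0 => e; apply: fd.
  by rewrite e; apply: tail'; lia.
case=> le /pal_windowP /(_ 0 isT); rewrite addn0 subSS subn0 => e; apply: fd.
by rewrite e; apply: tail'; lia.
Qed.

End Window.

(** * Strips of an array and the charging of palindromes to slots *)

Lemma pal_map (A B : eqType) (f : A -> B) (s : seq A) : pal s -> pal (map f s).
Proof. by rewrite /pal => /eqP {1}->; rewrite map_rev. Qed.

Definition dup_head (T : Type) (y : seq T) : seq T := take 1 y ++ y.

Section Grid.

Variables (T : eqType) (w : nat -> nat -> T) (m n : nat).
Implicit Types (y : seq T) (u v : seq (seq T)).

Definition strip s p j : seq T := window (w^~ j) s p.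

Lemma take_strip s p j : take p (strip s p.+1 j) = strip s p j.
Proof. by rewrite /strip /window -map_take take_iota (minn_idPl (leqnSn p)). Qed.

Lemma window_take s p c q :
  map (take p) (window (strip s p.+1) c q) = window (strip s p) c q.
Proof. by rewrite -map_comp; apply: eq_map => j /=; rewrite take_strip. Qed.

Definition occurs_in v s p :=
  exists2 c, c + size v <= n & window (strip s p) c (size v) = v.

Definition in_first_two v := exists s p c,
  [/\ 0 < p, s + p <= m, c + size v <= 2 & window (strip s p) c (size v) = v].

Definition chosen v s p :=
  [/\ ~ in_first_two v, occurs_in v s p & forall t, t < s -> ~ occurs_in v t p].

Definition in_col0 y := exists2 s, s + size y <= m & strip s (size y) 0 = y.

(* A slot [(l, s, p)] with [p] odd stands for the end column [l] in the strip of
   [p] rows from row [s]; a slot [(l, r, 0)] with [l = 1, 2] stands for the end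
   row [r] in the [l]-th column. *)
Inductive charge : seq (seq T) -> nat * nat * nat -> Prop :=
| ChargeCol1 y r : fresh (w^~ 0) r y -> charge [:: y] (1, r, 0)
| ChargeCol2 y r : fresh (w^~ 1) r y -> ~ in_col0 y -> charge [:: y] (2, r, 0)
| ChargeTwin y r : fresh (w^~ 1) r y -> in_first_two [:: y; y] ->
    in_col0 y -> charge [:: y; y] (2, r, 0)
| ChargeMissingTwin y r : fresh (w^~ 1) r y -> in_col0 y ->
    ~ in_first_two [:: y; y] -> charge [:: dup_head y] (2, r, 0)
| ChargeOdd v l s p : odd p -> fresh (strip s p) l v -> all (@pal T) v ->
    chosen v s p -> charge v (l, s, p)
| ChargeDup v l s p : odd p -> fresh (strip s p) l v -> all (@pal T) v ->
    ~ chosen v s p -> charge (map (@dup_head T) v) (l, s, p)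
| ChargeEven v l s p : odd p -> fresh (strip s p.+1) l v -> all (@pal T) v ->
    s + p.+1 <= m -> ~~ all (@constant T) v -> charge v (l, s, p)
| ChargeLetter l s p : ~ pal (strip s p l.-1) ->
    ~ (s + p.+1 <= m /\ pal (strip s p.+1 l.-1)) ->
    charge [:: nseq p.-1 (w s.+1 l.-1)] (l, s, p).

Lemma fresh_last (s p l : nat) v : fresh (strip s p) l v -> all (@pal T) v ->
  pal (strip s p l.-1).
Proof.
case=> _ v0 [c ce ev] _ /allP; apply; rewrite -ev; apply: map_f.
rewrite mem_iota; lia.
Qed.

(** If [u] is wider than [v], cutting its last row and reflecting gives an earlier copy of [v].
    Otherwise every column of [u] is a palindrome at heights [p] and [p.+1], hence constant. *)
Lemma fresh_strips s p l u v : fresh (strip s p) l v -> all (@pal T) v ->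
  fresh (strip s p.+1) l u -> all (@pal T) u -> all (@constant T) u.
Proof.
case=> pv v0 [d de ev] nv /allP apv [pu u0 [c ce eu] _] /allP apu.
have [lt|ge] := ltnP c d.
  case: (nv c); first by lia.
  rewrite -[RHS]ev; apply: (@pal_suffix _ _ _ (size u)); last 1 first.
  - exact: etrans de (esym ce).
  - by rewrite -window_take eu pal_map.
  - by rewrite ev.
  - exact: ltnW.
apply/allP => y; rewrite -{1}eu => /mapP[j]; rewrite mem_iota => ltj ej.
have := apu y; rewrite -{1}eu ej map_f ?mem_iota // => /(_ isT).
have : pal (strip s p j) by apply: apv; rewrite -ev map_f // mem_iota; lia.
by move=> p0 p1; rewrite /strip (pal_succ_const p0 p1) (constant_nseq).
Qed.

Lemma in_col0_twin y : 0 < size y -> in_first_two [:: y; y] -> in_col0 y.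
Proof.
move=> y0 [s [p [c [p0 le lec /= [e0 e1]]]]].
have c0 : c = 0 by move: lec => /=; lia.
have ep : p = size y by rewrite -e0 size_window.
by rewrite c0 in e0; exists s; rewrite -?ep.
Qed.

(** Two charges by one constructor agree by [fresh_inj], or by the form of [ChargeLetter].
    Constructors sharing a kind of slot are kept apart by [in_col0], [in_first_two] or [chosen], by
    [fresh_strips] for [ChargeEven] and by [fresh_last] for [ChargeLetter]. *)
Lemma charge_inj u v x : charge u x -> charge v x -> u = v.
Proof.
case=> {u x} [y r f1|y r f1 nc|y r f1 ft c0|y r f1 c0 nft
             |u l s p o f1 a1 ch|u l s p o f1 a1 ch|u l s p o f1 a1 le nc
             |l s p np np'] H; inversion H; subst => //; try tauto;
  repeat match goal with
  | h : fresh ?f ?e ?a, h' : fresh ?f ?e ?b |- _ =>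
      have ? := fresh_inj h h'; clear h'; subst
  | h : fresh (strip ?s ?p) _ ?a, h' : fresh (strip ?s ?p.+1) _ ?b |- _ =>
      exfalso; have := fresh_strips h _ h' _; intuition
  end; try tauto; try by [].
all: match goal with
  | h : fresh (strip _ _) _ _ |- _ => have := fresh_last h; tauto
  end.
Qed.

Definition odd_strips :=
  [seq (s, k.*2.+1) | k <- iota 0 (uphalf m), s <- iota 0 (m - k.*2)].

Definition slots :=
  [seq (1, r, 0) | r <- iota 1 m] ++ [seq (2, r, 0) | r <- iota 1 m] ++
  [seq (l, x.1, x.2) | l <- iota 3 (n - 2), x <- odd_strips].

Lemma col1_slot r : 0 < r <= m -> (1, r, 0) \in slots.
Proof. by move=> h; rewrite !mem_cat map_f // mem_iota; lia. Qed.

Lemma col2_slot r : 0 < r <= m -> (2, r, 0) \in slots.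
Proof.
move=> h; rewrite !mem_cat [X in _ || (X || _)]map_f ?orbT // mem_iota; lia.
Qed.

Lemma strip_slot l s p : 3 <= l <= n -> odd p -> s + p <= m ->
  (l, s, p) \in slots.
Proof.
move=> hl op le; rewrite !mem_cat; apply/orP; right; apply/orP; right.
apply/allpairsP; exists (l, (s, p)); split=> //=; first by rewrite mem_iota; lia.
apply/allpairsPdep; exists p./2, s; rewrite !mem_iota; split=> //; last 1 first.
  by congr pair; lia.
all: lia.
Qed.

Lemma size_slots : size slots = 2 * m + (n - 2) * (uphalf m * (half m).+1).
Proof.
rewrite !size_cat !size_map size_allpairs !size_iota.
suff -> : size odd_strips = uphalf m * (half m).+1 by lia.
(* There are [m - 2k] strips of height [2k + 1]; at [h = uphalf m] the factor [m.+1 - h] is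
   [(half m).+1]. *)
have gen h : h <= uphalf m ->
    size [seq (s, k.*2.+1) | k <- iota 0 h, s <- iota 0 (m - k.*2)] =
    h * (m.+1 - h).
  elim: h => // h IH lt; rewrite -addn1 iotaD map_cat flatten_cat size_cat.
  by rewrite IH ?(ltnW lt) //= cats0 size_map size_iota; nia.
by rewrite gen //; congr muln; lia.
Qed.

(** * Finding a slot for each palindrome *)

Lemma fresh_end_gt2 s p l v : 0 < p -> s + p <= m -> ~ in_first_two v ->
  fresh (strip s p) l v -> 2 < l.
Proof.
move=> p0 le nb [_ _ [c ce ev] _]; rewrite ltnNge; apply/negP => le2; apply: nb.
by exists s, p, c; split=> //; rewrite ce.
Qed.

Lemma window_dup_head t k d q v : 0 < k ->
  window (strip t k) d q = v -> window (strip t.+1 k) d q = v ->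
  window (strip t k.+1) d q = map (@dup_head T) v.
Proof.
move=> k0 e0 e1; rewrite -{1}e1 -map_comp; apply/eq_in_map => j jq /=.
have ej : strip t k j = strip t.+1 k j.
  have lt : j - d < q by move: jq; rewrite mem_iota; lia.
  have := iffLR (eq_windowP _ _ _ _ _) (etrans e0 (esym e1)) _ lt.
  by rewrite subnKC //; move: jq; rewrite mem_iota; lia.
case: k k0 {e0 e1} ej => // k _.
by rewrite /dup_head /strip /window /= take0 => -[->].
Qed.

(** The case of even height with constant columns: [map dup_head v] takes an end that [v] leaves
    free, and if there is none the word is a single column. *)
Lemma charge_const s k c v : odd k -> s + k.+1 <= m -> 0 < size v ->
  c + size v <= n -> window (strip s k) c (size v) = v ->
  window (strip s.+1 k) c (size v) = v -> pal v -> all (@pal T) v ->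
  all (@constant T) v -> ~ in_first_two (map (@dup_head T) v) ->
  exists2 x, x \in slots & charge (map (@dup_head T) v) x.
Proof.
move=> ok le v0 lec e0 e1 pv apv cv nb.
have k0 : 0 < k by case: k ok {le e0 e1}.
have NI t d : t + k.+1 <= m -> d + size v <= 2 ->
    window (strip t k) d (size v) = v -> window (strip t.+1 k) d (size v) <> v.
  move=> let_ led h0 h1; apply: nb; exists t, k.+1, d.
  by rewrite size_map (window_dup_head k0 h0 h1).
have [[t [l [let_ lel f nch]]]|no] := classic (exists t l,
   [/\ t + k <= m, 3 <= l <= n, fresh (strip t k) l v & ~ chosen v t k]).
  exists (l, t, k); first exact: strip_slot.
  exact: ChargeDup.
have K1 t d : t + k <= m -> d + size v <= n ->
   window (strip t k) d (size v) = v ->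
   (exists2 d', d' + size v <= 2 & window (strip t k) d' (size v) = v)
   \/ chosen v t k.
  move=> let_ led h; have [l lel f] := fresh_ex pv v0 h.
  case: (leqP l 2) => l2.
    by left; case: f => _ _ [d' ed' h'] _; exists d'; rewrite ?ed'.
  right; apply: NNPP => nch; apply: no; exists t, l; split=> //.
  by rewrite l2 (leq_trans lel).
have le_s : s + k <= m by lia.
have le_sS : s.+1 + k <= m by lia.
(* Otherwise the strips at [s] and [s.+1] would both be chosen, but only the topmost one is. *)
have inb : in_first_two v.
  apply: NNPP => ninb.
  have [[d led h]|ch0] := K1 s c le_s lec e0.
    by apply: ninb; exists s, k, d.
  have [[d led h]|[_ _ /(_ s)]] := K1 s.+1 c le_sS lec e1.
    by apply: ninb; exists s.+1, k, d.
  by apply=> //; case: ch0.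
have K t d : t + k <= m -> d + size v <= n -> window (strip t k) d (size v) = v ->
   exists2 d', d' + size v <= 2 & window (strip t k) d' (size v) = v.
  by move=> let_ led h; case: (K1 _ _ let_ led h) => // -[].
have [d0 le0 h0] := K s c le_s lec e0.
have [d1 le1 h1] := K s.+1 c le_sS lec e1.
(* A common position would put the even word in the first two columns; two distinct positions there
   force width one. *)
have ned : d0 <> d1 by move=> e; apply: NI le le0 h0 _; rewrite e.
have sv : size v = 1 by lia.
case: v sv {v0 inb K1 no} pv apv cv nb NI K lec e0 e1 le0 le1 h0 h1
  => [|y []] //= _.
rewrite !andbT /window /= => _ py cy nb NI K lec [e0] [e1] le0 le1 [h0] [h1].
have sy : size y = k by rewrite -e0 size_window.
have [t0 let0 g0] : in_col0 y.
  have [ed|ed] : d0 = 0 \/ d1 = 0 by lia.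
    by exists s; rewrite sy -?ed.
  by exists s.+1; rewrite sy -?ed.
have [t1 let1 g1] : exists2 t1, t1 + k <= m & strip t1 k 1 = y.
  have [ed|ed] : d0 = 1 \/ d1 = 1 by lia.
    by exists s; rewrite -?ed.
  by exists s.+1; rewrite -?ed.
rewrite -sy in g1; have y0 : 0 < size y by rewrite sy.
have [r ler fr] := fresh_ex py y0 g1.
have r0 : 0 < r by case: fr => _ _ [? <- _] _; rewrite addn_gt0 y0 orbT.
have yc : in_col0 y by exists t0.
have [a ey] : exists a, y = nseq k a.
  by case: (y) sy cy => [<-|b y' <- /all_pred1P {1}->]; [exists (w 0 0)|exists b].
have ed : dup_head y = nseq k.+1 a.
  by rewrite ey /dup_head; case: (k) k0 => //= k'; rewrite take0.
have c2 : 2 <= c.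
  rewrite ltnNge; apply/negP => lec1; apply: (NI s c) => //; first by lia.
    by rewrite e0.
  by rewrite e1.
have colc : strip s k.+1 c = nseq k.+1 a.
  by apply: window_nseqS => //; rewrite -ey.
have [nona|alla] := classic (exists2 i, i < m & w i c <> a).
  (* The window is [b a^(k+1)] or [a^(k+1) b]; either way its second letter is [a], so the slot
     determines the word. *)
  have [|z [lez wz np np']] := nonpal_window _ le colc nona; first by lia.
  exists (c.+1, z, k.+2).
    by apply: strip_slot => //=; [lia|rewrite negbK].
  by rewrite ed -wz; apply: (@ChargeLetter c.+1 z k.+2).
exists (2, r, 0); first by apply: col2_slot; lia.
(* Column [c] is now constantly [a], so every strip of height [k] holds [y], by [K] within the first
   two columns. If strip [t] held the twin, a neighbouring strip would share a column with it, and
   the even word would lie there. *)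
apply: ChargeMissingTwin => // -[t [p [d [_ letp /= led [hd0 hd1]]]]].
have ep : p = k by rewrite -sy -hd0 size_window.
have d00 : d = 0 by lia.
subst p d.
have colt t' : t' + k <= m -> [:: strip t' k c] = [:: y].
  move=> let'; congr cons; rewrite ey; apply/window_nseqP => i lti.
  by apply: NNPP => na; apply: alla; exists (t' + i); first by lia.
have twin d' : d' + 1 <= 2 -> [:: strip t k d'] = [:: y].
  by case: d' => [|[|d']] led'; rewrite ?hd0 ?hd1 //; lia.
have [lt|ge] := leqP (t + k.+1) m.
  have lt' : t.+1 + k <= m by lia.
  have [d' led' hd'] := K _ _ lt' lec (colt _ lt').
  exact: (NI t d' lt led' (twin _ led') hd').
case: t {hd0 hd1} letp twin ge => [|t] letp twin ge; first by lia.
have lt' : t + k <= m by lia.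
have [d' led' hd'] := K _ _ lt' lec (colt _ lt').
by apply: (NI t d') hd' (twin _ led'); lia.
Qed.

Lemma charge_ex s p c u : 0 < p -> s + p <= m -> 0 < size u ->
  c + size u <= n -> window (strip s p) c (size u) = u ->
  pal u -> all (@pal T) u -> exists2 x, x \in slots & charge u x.
Proof.
move=> p0 lep u0 lec eu pu apu.
have [[t [p' [d [p'0 lep' led ed]]]]|nb] := classic (in_first_two u).
  have [su|su] : size u = 1 \/ size u = 2 by lia.
    case: u su {u0 lec eu pu} apu led ed => [|y []] //= _ /andP[py _] led [ey].
    have sy : size y = p' by rewrite -ey size_window.
    have y0 : 0 < size y by rewrite sy.
    have [[t' let' ey']|nc] := classic (in_col0 y).
      have [r ler fr] := fresh_ex py y0 ey'.
      exists (1, r, 0); last exact: ChargeCol1.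
      apply: col1_slot; case: fr => _ _ [? er _] _; lia.
    have d1 : d = 1.
      case: d ey led => [ey _|d _ led]; last by lia.
      by case: nc; exists t; rewrite sy.
    rewrite d1 -sy in ey; have [r ler fr] := fresh_ex py y0 ey.
    exists (2, r, 0); last exact: ChargeCol2.
    apply: col2_slot; case: fr => _ _ [? er _] _; lia.
  case: u su {u0 lec eu} pu apu led ed => [|y [|y' []]] //= _.
  rewrite /pal /rev /= => /eqP[<- _] /andP[py _] led [ey ey'].
  have d0 : d = 0 by lia.
  have sy : size y = p' by rewrite -ey size_window.
  have y0 : 0 < size y by rewrite sy.
  have tw : in_first_two [:: y; y].
    by exists t, p', d; split=> //=; rewrite /window /= ey ey'.
  rewrite d0 -sy in ey'; have [r ler fr] := fresh_ex py y0 ey'.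
  exists (2, r, 0); last by apply: ChargeTwin => //; apply: in_col0_twin.
  apply: col2_slot; case: fr => _ _ [? er _] _; lia.
have [op|ep] := boolP (odd p).
  have [|t [[lt [d led ed]] tmin]] :=
      @ex_least (fun t => t + p <= m /\ occurs_in u t p).
    by exists s; split=> //; exists c.
  have [l lel f] := fresh_ex pu u0 ed.
  exists (l, t, p).
    apply: strip_slot => //; rewrite (leq_trans lel) // andbT.
    exact: fresh_end_gt2 f.
  apply: ChargeOdd => //; split=> //; first by exists d.
  by move=> t' lt' oc; apply: (tmin _ lt'); split=> //; lia.
case: p p0 ep lep eu => // k _ /=; rewrite negbK => ok lep eu.
have [cu|ncu] := boolP (all (@constant T) u); last first.
  have [l lel f] := fresh_ex pu u0 eu.
  exists (l, s, k); last exact: ChargeEven.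
  apply: strip_slot => //; last by lia.
  by rewrite (leq_trans lel) // andbT; apply: fresh_end_gt2 f.
have k0 : 0 < k by case: k ok {lep eu}.
(* With constant columns, dropping the first or the last row leaves the same word. *)
have e1 : window (strip s.+1 k) c (size u) = map behead u.
  by rewrite -[in RHS]eu -map_comp.
have e0 : window (strip s k) c (size u) = map behead u.
  rewrite -window_take eu; apply/eq_in_map => y yu.
  have sy : size y = k.+1.
    by move: yu; rewrite -eu => /mapP[j _ ->]; rewrite size_window.
  move: (allP cu _ yu); case: y sy {yu} => //= b y [sy] /all_pred1P ->.
  by rewrite sy -[b :: _]/(nseq k.+1 b) take_nseq.
have eud : u = map (@dup_head T) (map behead u).
  by rewrite -(window_dup_head k0 e0 e1).
rewrite eud; apply: (@charge_const s k c); rewrite ?size_map -?eud //.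
- exact: pal_map.
- apply/allP => _ /mapP[y /(allP cu) cy ->].
  case: y cy => //= b y /all_pred1P ->; apply/eqP.
  by rewrite rev_nseq.
apply/allP => _ /mapP[y /(allP cu) cy ->].
by case: y cy => //= b y /all_pred1P ->; rewrite constant_nseq.
Qed.

End Grid.

(** * Arrays as sequences of columns *)

Section SmallWords.

Variables (T : finType) (m n : nat).

Definition columns p q (u : 'M[T]_(p, q)) : seq (seq T) :=
  [seq col_word u j | j : 'I_q].

Lemma image_ord_window (A : eqType) (f : nat -> A) c q (F : 'I_q -> A) :
  (forall j, F j = f (c + j)) -> [seq F j | j : 'I_q] = window f c q.
Proof.
move=> eF; rewrite /image_mem (eq_map eF) /window -[in iota c q](addn0 c) iotaDl.
by rewrite -val_enum_ord -!map_comp.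
Qed.

Lemma columns_inj (u v : small_word T m n) :
  0 < (tag u).1 -> 0 < (tag u).2 ->
  columns (tagged u) = columns (tagged v) -> u = v.
Proof.
case: u v => [[p q] u] [[p' q'] v] /= p0 q0 euv.
have eq : q = q'.
  by apply/val_inj; move/(congr1 size): euv; rewrite !size_image !card_ord.
subst q'.
have ecol j : col_word u j = col_word v j.
  by move/eq_in_map: euv; apply; rewrite mem_enum.
have ep : p = p'.
  apply/val_inj; move/(congr1 size): (ecol (Ordinal q0)).
  by rewrite !size_image !card_ord.
subst p'; congr Tagged; apply/matrixP => i j.
by move/eq_in_map: (ecol j); apply; rewrite mem_enum.
Qed.

Lemma HV_palindrome_pal p q (u : 'M[T]_(p, q)) : HV_palindrome u ->
  pal (columns u) && all (@pal T) (columns u).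
Proof.
case/andP=> /forallP rows /forallP cols; apply/andP; split; last first.
  by apply/allP => _ /mapP[j _ ->]; apply: cols.
have [q0|q0] := posnP q.
  by rewrite /columns /image_mem (size0nil (etrans (size_enum_ord q) q0)).
pose j0 := Ordinal q0.
apply/eqP; rewrite /columns /image_mem -map_rev.
have := size_enum_ord q; move: rows; rewrite /row_word /image_mem.
move: (enum 'I_q) => e rows se.
apply: (@eq_from_nth _ [::]) => [|j]; first by rewrite size_map size_map size_rev.
rewrite size_map => lt; rewrite !(nth_map j0) ?size_rev //.
apply: eq_map => i; have /eqP := rows i.
rewrite -map_rev => /(congr1 (fun s => nth (u i j0) s j)).
by rewrite !(nth_map j0) ?size_rev.
Qed.

End SmallWords.

Lemma card_HV_palindromic_factors (T : finType) m n (w : 'M[T]_(m.+1, n.+1)) :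
  #|HV_palindromic_factors w| <=
  2 * m.+1 + (n.+1 - 2) * (uphalf m.+1 * (half m.+1).+1).
Proof.
(* Out of range, [inord] falls back to row or column 0. *)
pose f i j := w (inord i) (inord j).
rewrite -(size_slots m.+1 n.+1) cardE.
pose R (u : small_word T m.+1 n.+1) x :=
  [/\ 0 < (tag u).1, 0 < (tag u).2 & charge f m.+1 n.+1 (columns (tagged u)) x].
apply: (@leq_size_rel _ _ R) (enum_uniq _) _ _; last first.
  move=> u v x [p0 q0 cu] [_ _ cv]; apply: columns_inj => //.
  exact: charge_inj cu cv.
move=> u; rewrite mem_enum inE => /and4P[p0 q0 /existsP[a /existsP[c oc]] hv].
have [pu apu] := andP (HV_palindrome_pal hv).
case/and3P: oc => lea lec /forallP oc.
have su : size (columns (tagged u)) = (tag u).2 by rewrite size_image card_ord.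
have eu : window (strip f a (tag u).1) c (tag u).2 = columns (tagged u).
  apply/esym/image_ord_window => j; apply: image_ord_window => i.
  move: (oc i) => /forallP/(_ j)/forallP/(_ (inord (a + i)))/forallP.
  move=> /(_ (inord (c + j)))/implyP h; apply/eqP/h.
  have := ltn_ord i; have := ltn_ord j => ltj lti.
  by rewrite !inordK ?eqxx //; lia.
have u0 : 0 < size (columns (tagged u)) by rewrite su.
have le_u : c + size (columns (tagged u)) <= n.+1 by rewrite su.
rewrite -[X in window _ _ X]su in eu.
have [x xs ch] := charge_ex p0 lea u0 le_u eu pu apu.
by exists x.
Qed.

(** * The bound in rational form *)

Import Order.TTheory GRing.Theory Num.Theory.
Local Open Scope ring_scope.

Theorem theorem5p5 (m n : nat) (hm : (2 <= m)%N) (hn : (2 <= n)%N)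
    (T : finType) (w : 'M[T]_(m, n)) :
  #|HV_palindromic_factors w|%:R <=
    (if odd m
     then (n%:R - 2) * ((m%:R + 1) / 2) ^+ 2 + 2 * m%:R
     else m%:R / 2 * ((m%:R / 2 + 1) * n%:R - m%:R + 2)) :> rat.
Proof.
case: m n hm hn w => // m [//|n] hm hn w.
pose b := (2 * m.+1 + (n.+1 - 2) * (uphalf m.+1 * (half m.+1).+1))%N.
apply: (@le_trans _ _ b%:R).
  by rewrite ler_nat card_HV_palindromic_factors.
rewrite {}/b; move: (m.+1) (n.+1) hm hn => {w}{}m {}n hm hn.
rewrite natrD !natrM natrB // -(@natr1 _ m./2) uphalf_half natrD.
(* With [m] split into parity and half, the slot count equals the stated bound in both cases. *)
have em : m%:R = (odd m)%:R + m./2%:R * 2 :> rat.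
  by rewrite -natrM -natrD; congr _%:R; rewrite muln2 odd_double_half.
rewrite {}em le_eqVlt; apply/orP; left.
by case: (odd m); apply/eqP => /=; field.
Qed.
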